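(* Let $f_1,\ldots,f_k \in \mathbb{R}[X]$ be $k$ distinct polynomials of the form $f_i(x)=(x+a_i)^{e_i}$, where $a_i\in\mathbb{R}$ and $e_i$ are nonnegative integers. For each positive integer $j$, let $n_j$ denote the number of polynomials of degree less than $j$ in the family $(f_i)_{1\le i\le k}$. If $n_1 \leq 1$ and $n_j+n_{j-1} \leq j$ for all $j\ge 2$, then the family $(f_i)_{1\le i\le k}$ is linearly independent over $\mathbb{R}$. *)

(* Defs.v *)
From mathcomp Require Import all_boot all_order all_algebra.
From mathcomp Require Import reals.

Set Implicit Arguments.
Unset Strict Implicit.
Unset Printing Implicit Defensive.

Import GRing.Theory.
Local Open Scope ring_scope.

(* The library's [free] requires a finite-dimensional ambient space, which     *)
(* {poly R} is not.                                                            *)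
Definition linearly_independent (R : nzRingType) (V : lmodType R) (k : nat)
    (v : 'I_k -> V) : Prop :=
  forall c : 'I_k -> R, \sum_(i < k) c i *: v i = 0 -> forall i, c i = 0.

(* The zero polynomial gets degree 0. *)
Definition degree (R : nzRingType) (p : {poly R}) : nat := (size p).-1.

Definition num_deg_lt (R : nzRingType) (k : nat) (f : 'I_k -> {poly R})
    (j : nat) : nat :=
  #|[set i : 'I_k | (degree (f i) < j)%N]|.

(* Main.v *)
Require Import Defs.
From mathcomp Require Import all_boot all_order all_algebra.
From mathcomp Require Import reals.
From mathcomp Require Import polyorder polyrcf.
From mathcomp Require Import zify.

(* The linear form p |-> p^(D-e)(a) on polynomials of degree at most D is dual *)
(* to (X + a)^e, so a linear relation between the f_i makes one of the         *)
(* Birkhoff conditions p^(D-e_i)(a_i) = 0 a consequence of the others.         *)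
(* Grouping the exponents at each point greedily into disjoint pairs {e, e+1}  *)
(* costs at most n_j + n_(j-1) <= j conditions of exponent less than j;        *)
(* completing them with a zero of high order at a fresh point b gives D + 1    *)
(* conditions, one of them redundant, hence a nonzero p of degree n <= D which *)
(* satisfies all of them. This contradicts a Budan-Fourier count: if a run of  *)
(* l consecutive vanishing derivatives at a point weighs l when it starts at p *)
(* itself and 2 floor(l/2) otherwise, the total weight over all points is at   *)
(* most n. The count goes by induction from p' to p, using that two            *)
(* consecutive roots of p enclose a root of p' of odd multiplicity.            *)

Set Implicit Arguments.
Unset Strict Implicit.
Unset Printing Implicit Defensive.

Import Order.TTheory GRing.Theory Num.Theory.
Local Open Scope ring_scope.

(** The duality is [derivn_horner_dual], the polynomial p comes from [exists_poly_derivn_root], and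
    the Budan-Fourier count is [sum_prefix_weight_le], applied to pairs of conditions in
    [birkhoff_pairs_le]. With g pairs and a zero of order D + 1 - 2g at b, the count for p of degree
    n forces at least (D + 1 - n)/2 pairs to have derivation orders above n, where they hold
    trivially. Such pairs start at distinct f_i of exponent below D - n - 1, and for j = D - n the
    hypothesis gives 2 n_(j-1) <= n_j + n_(j-1) <= j: a contradiction. *)

(** * Rolle's theorem with parity of multiplicities *)

Section RolleParity.
Variable R : rcfType.
Implicit Types (p : {poly R}) (a b c x : R).

(** Each root r in the interval yields a square factor (X - r)^2, which does not affect signs; once
    all are divided out, the intermediate value theorem applies. *)
Lemma even_mu_sign p a b : p != 0 ->
    {in `]a, b[, forall x, ~~ odd (\mu_x p)} ->
  {in `]a, b[ &, forall x y, 0 <= p.[x] * p.[y]}.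
Proof.
have [n] := ubnP (size p); elim: n p => // n IHn p lt_p_n p0 even_p.
case def_s: (roots p a b) => [|r s]; last first.
  have /[!in_roots]/and3P[rpr rab _] : r \in roots p a b by rewrite def_s mem_head.
  have mu2 : (1 < \mu_r p)%N.
    have := even_p _ rab; rewrite -(mu_gt0 _ p0) in rpr.
    by case: (\mu_r p) rpr => [|[]].
  move: (mu2); rewrite -root_le_mu // => /dvdpP[q def_p].
  have q0 : q != 0 by apply: contraNneq p0 => q0; rewrite def_p q0 mul0r.
  have lt_q_n : (size q < n)%N.
    move: lt_p_n; rewrite def_p size_Mmonic ?monic_exp ?monicXsubC //.
    by rewrite size_exp_XsubC addn3 /= ltnS => /ltnW.
  have even_q : {in `]a, b[, forall x, ~~ odd (\mu_x q)}.
    move=> x /even_p; rewrite def_p mu_mul -?def_p // oddD mu_exp muln2 odd_double.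
    by rewrite addbF.
  move=> x y xab yab; rewrite def_p !hornerM -!expr2 mulrACA.
  by rewrite mulr_ge0 ?IHn // mulr_ge0 // sqr_ge0.
have norootp x : x \in `]a, b[ -> ~~ root p x.
  move=> xab; apply/negP => rpx.
  by have := in_roots p a b x; rewrite def_s rpx xab p0.
move=> x y; wlog le_xy : x y / x <= y => [hw xab yab|xab yab].
  by have /orP[/hw|/hw] := le_total x y; [|rewrite mulrC]; apply.
rewrite leNgt; apply/negP => /(poly_ivtoo le_xy)[z zxy rpz].
have zab : z \in `]a, b[.
  move: xab yab zxy; rewrite !in_itv /= => /andP[ax _] /andP[_ yb] /andP[xz zy].
  by rewrite (lt_trans ax xz) (lt_trans zy yb).
by have := norootp z zab; rewrite rpz.
Qed.

(** The mean value theorem on the two halves of the interval gives values of p' of opposite signs,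
    which [even_mu_sign] excludes if all multiplicities are even. *)
Lemma rolle_odd_mu p a b : a < b -> root p a -> root p b ->
    {in `]a, b[, forall x, ~~ root p x} ->
  exists2 c, c \in `]a, b[ & odd (\mu_c p^`()).
Proof.
move=> ab rpa rpb nor; pose m := (a + b) / 2%:R.
have m_ab : m \in `]a, b[ by rewrite in_itv /= !midf_lt.
have [am mb] : a < m /\ m < b by apply/andP; rewrite in_itv in m_ab.
have pm0 : p.[m] != 0 by exact: nor.
have [c cam dc] := poly_mvt p am; have [d dmb dd] := poly_mvt p mb.
rewrite (eqP rpa) subr0 in dc; rewrite (eqP rpb) sub0r in dd.
have p'0 : p^`() != 0.
  by apply: contraNneq pm0 => p'0; rewrite dc p'0 horner0 mul0r.
have cab : c \in `]a, b[.
  by rewrite in_itv /= (itvP cam) (lt_trans _ mb) // (itvP cam).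
have dab : d \in `]a, b[.
  by rewrite in_itv /= (itvP dmb) (lt_trans am) // (itvP dmb).
case: (boolP (has (fun x => odd (\mu_x p^`())) (roots p^`() a b))).
  by move=> /hasP[x]; rewrite in_roots => /and3P[_ xab _] odd_x; exists x.
move=> /hasPn even_p'.
have /(_ c d cab dab) : {in `]a, b[ &, forall x y, 0 <= p^`().[x] * p^`().[y]}.
  apply: even_mu_sign => // x xab.
  have [rx|/muNroot->//] := boolP (root p^`() x).
  by apply: even_p'; rewrite in_roots rx xab p'0.
rewrite leNgt => /negP[].
have mb0 : 0 < b - m by rewrite subr_gt0.
have am0 : 0 < m - a by rewrite subr_gt0.
rewrite -(pmulr_llt0 _ (mulr_gt0 am0 mb0)) mulrACA -dc -dd mulrN oppr_lt0.
by rewrite -expr2 exprn_even_gt0.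
Qed.

Lemma size_roots_odd_critical p (s C : seq R) : sorted <%R s ->
    (forall x, root p x = (x \in s)) ->
    (forall c, odd (\mu_c p^`()) -> ~~ root p c -> c \in C) ->
  (size s <= (count (fun c => ~~ root p c && odd (\mu_c p^`())) C).+1)%N.
Proof.
case: s => [//|x s] /= ord_s root_s inC; rewrite ltnS.
set good := fun c => _.
(* Counting only to the right of the first root makes the induction work: moving from a root x to
   the next root y loses the critical point between them. *)
suff: (size s <= count (fun c => (x < c)%R && good c) C)%N.
  by move/leq_trans; apply; apply: sub_count => c /= /andP[].
have rpx : root p x by rewrite root_s mem_head.
have {}root_s z : x < z -> root p z = (z \in s).
  by move=> xz; rewrite root_s inE gt_eqF.
elim: s x ord_s rpx root_s => //= y s IHs x /andP[xy ord_s] rpx root_s.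
have rpy : root p y by rewrite root_s ?mem_head.
have root_s' z : y < z -> root p z = (z \in s).
  by move=> yz; rewrite root_s ?(lt_trans xy) // inE gt_eqF.
have nor : {in `]x, y[, forall z, ~~ root p z}.
  move=> z; rewrite in_itv /= => /andP[xz zy]; rewrite root_s // inE lt_eqF //=.
  apply: contraTN zy => /(allP (order_path_min lt_trans ord_s)) yz.
  by rewrite -leNgt ltW.
have [c cxy odd_c] := rolle_odd_mu xy rpx rpy nor.
have cC : c \in C by rewrite inC ?nor.
apply: leq_ltn_trans (IHs y ord_s rpy root_s') _.
have xc : x < c by rewrite (itvP cxy).
have cy : c < y by rewrite (itvP cxy).
rewrite -!size_filter; set s1 := filter _ C; set s2 := filter _ C.
have -> : s1 = filter (fun c => y < c) s2.
  rewrite -filter_predI; apply: eq_filter => z /=.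
  by have [yz|] := boolP (y < z) => //=; rewrite (lt_trans xy yz).
rewrite size_filter -(count_predC (fun c => (y < c)%R) s2) -[X in (X < _)%N]addn0.
rewrite ltn_add2l -has_count; apply/hasP; exists c; last by rewrite /= -leNgt ltW.
by rewrite mem_filter xc /good nor ?odd_c.
Qed.
End RolleParity.

(** * Weights of runs in Boolean sequences *)

Section RunWeights.
Implicit Types (s : seq bool) (t : seq nat).

(* Each maximal run of l [true]s counts for 2 floor(l/2); [pending] records an  *)
(* unpaired [true] just before [s].                                            *)
Fixpoint paired_weight (pending : bool) s : nat :=
  if s is b :: s' then
    if b then
      if pending then (paired_weight false s').+2 else paired_weight true s'
    else paired_weight false s'
  else 0%N.

(* As [paired_weight false], except that the initial run counts in full. *)
Fixpoint prefix_weight s : nat :=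
  if s is b :: s' then
    if b then (prefix_weight s').+1 else paired_weight false s'
  else 0%N.

Fixpoint leading_run s : nat :=
  if s is true :: s' then (leading_run s').+1 else 0%N.

(** An extra [true] in front completes one more pair exactly when the run it extends has odd
    length. *)
Lemma paired_weight_pending s :
  paired_weight true s = (paired_weight false s + (odd (leading_run s)).*2)%N.
Proof.
elim: s => [|[] s IHs] //=; last by rewrite addn0.
by rewrite IHs; case: odd => /=; lia.
Qed.

Lemma prefix_weightE s :
  prefix_weight s = (paired_weight false s + odd (leading_run s))%N.
Proof.
elim: s => [|[] s IHs] //=; last by rewrite addn0.
by rewrite IHs paired_weight_pending; case: odd => /=; lia.
Qed.

Lemma leq_paired_prefix_weight s : (paired_weight false s <= prefix_weight s)%N.
Proof. by rewrite prefix_weightE leq_addr. Qed.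

Lemma count_iotaS (P : pred nat) n :
  count P (iota 0 n.+1) = (P 0%N + count (fun q => P q.+1) (iota 0 n))%N.
Proof. by rewrite /= -[1%N]/(1 + 0)%N iotaDl count_map. Qed.

(** [P] marks the left ends of disjoint pairs of adjacent [true]s, and a run of length l holds at
    most floor(l/2) of them. *)
Lemma leq_pairs_weight (P : pred nat) s :
    (forall q, P q -> [/\ nth false s q, nth false s q.+1 & ~~ P q.+1]) ->
  ((count P (iota 0 (size s))).*2 <= paired_weight false s)%N.
Proof.
have [n] := ubnP (size s); elim: n s P => // n IHn s P.
case: s => [//|b s] lt_s_n Ps; rewrite [size _]/= count_iotaS.
have IH1 : ((count (fun q => P q.+1) (iota 0 (size s))).*2 <= paired_weight false s)%N.
  by apply: IHn => // q /Ps[].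
case: (boolP (P 0%N)) => [P0|_]; last first.
  by case: b {Ps lt_s_n} => //=; rewrite paired_weight_pending add0n (leq_trans IH1) ?leq_addr.
have [/= bt] := Ps _ P0; case: s lt_s_n Ps {IH1} => [//|b' s] lt_s_n Ps b't P1.
rewrite [size _]/= count_iotaS (negbTE P1) add0n add1n doubleS bt /=.
rewrite /= in b't; rewrite b't !ltnS; apply: IHn => [|q /Ps[]//]; exact: ltnW.
Qed.

Lemma leq_seq_pairs_weight t s : uniq t ->
    (forall q, q \in t -> [/\ nth false s q, nth false s q.+1 & q.+1 \notin t]) ->
  ((size t).*2 <= paired_weight false s)%N.
Proof.
move=> uniq_t ts; apply: leq_trans (@leq_pairs_weight (mem t) s ts).
rewrite leq_double -size_filter uniq_leq_size // => q qt.
rewrite mem_filter mem_iota /= qt add0n ltnNge.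
by apply/negP => /(nth_default false) sq; have [] := ts q qt; rewrite sq.
Qed.

Lemma leq_prefix_weight k s :
  (forall q, (q < k)%N -> nth false s q) -> (k <= prefix_weight s)%N.
Proof.
elim: s k => [|b s IHs] [|k] //= sk; first by have := sk 0%N isT.
by have /= -> := sk 0%N isT; rewrite ltnS; apply: IHs => q; apply: (sk q.+1).
Qed.

End RunWeights.

(** * The Budan-Fourier count *)

Section BudanFourier.
Variable R : rcfType.
Implicit Types (p : {poly R}) (c : R) (A : seq R).

Definition zero_pattern p c n : seq bool := mkseq (fun j => root p^`(j) c) n.

Lemma zero_patternS p c n :
  zero_pattern p c n.+1 = root p c :: zero_pattern p^`() c n.
Proof.
rewrite /zero_pattern /mkseq /= -[1%N]/(1 + 0)%N iotaDl -map_comp.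
by congr cons; apply: eq_map => j; rewrite -derivSn.
Qed.

(** Truncation at n loses nothing, since the n-th derivative is a nonzero constant. *)
Lemma leading_run_mu p c n : size p = n.+1 ->
  leading_run (zero_pattern p c n) = \mu_c p.
Proof.
elim: n p => [|n IHn] p sz_p.
  by move/eqP: sz_p => /size_poly1P[a a0 ->]; rewrite mu_polyC.
have p0 : p != 0 by rewrite -size_poly_gt0 sz_p.
rewrite zero_patternS; case: (boolP (root p c)) => [rpc|/muNroot-> //] /=.
by rewrite IHn ?size_deriv ?sz_p // (mu_deriv_root p0 rpc) addn1.
Qed.

(** From p' to p, the weight at c grows by one if c is a root of p; otherwise the initial run of p'
    ceases to be initial and loses one if its length, the multiplicity of c in p', is odd. By
    [size_roots_odd_critical] the gains exceed the losses by at most one, as does the degree. *)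
Lemma sum_prefix_weight_le p A n : size p = n.+1 -> uniq A ->
  (\sum_(c <- A) prefix_weight (zero_pattern p c n) <= n)%N.
Proof.
elim: n p A => [|n IHn] p A sz_p uniq_A; first by rewrite big1.
have p0 : p != 0 by rewrite -size_poly_gt0 sz_p.
have sz_p' : size p^`() = n.+1 by rewrite size_deriv sz_p.
have p'0 : p^`() != 0 by rewrite -size_poly_gt0 sz_p'.
(* All roots of p' are added so that every loss is counted; weights are nonnegative, so the sum over
   [A] is still bounded. *)
pose B := A ++ [seq c <- rootsR p^`() | c \notin A].
have uniq_B : uniq B.
  rewrite cat_uniq uniq_A filter_uniq ?uniq_roots //= andbT -all_predC.
  by apply/allP => c; rewrite mem_filter => /andP[].
apply: (@leq_trans (\sum_(c <- B) prefix_weight (zero_pattern p c n.+1))%N).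
  by rewrite big_cat leq_addr.
have step c : (prefix_weight (zero_pattern p c n.+1) +
    (~~ root p c && odd (\mu_c p^`())) =
    root p c + prefix_weight (zero_pattern p^`() c n))%N.
  rewrite zero_patternS /=; case: root => /=; first by rewrite addn0.
  by rewrite prefix_weightE leading_run_mu.
have := IHn p^`() B sz_p' uniq_B.
have : (count (root p) B <= (count (fun c => ~~ root p c && odd (\mu_c p^`())) B).+1)%N.
  apply: (@leq_trans (size (rootsR p))).
    rewrite -size_filter uniq_leq_size ?filter_uniq // => c.
    by rewrite mem_filter => /andP[rpc _]; rewrite -(roots_on_rootsR p0) rpc.
  apply: size_roots_odd_critical.
  - exact: sorted_roots.
  - by move=> x; rewrite -(roots_on_rootsR p0).
  - move=> c odd_c _; rewrite mem_cat mem_filter; case: (c \in A) => //=.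
    by rewrite -(roots_on_rootsR p'0) /= -mu_gt0 // odd_gt0.
have : (\sum_(c <- B) prefix_weight (zero_pattern p c n.+1) +
   count (fun c => ~~ root p c && odd (\mu_c p^`())) B =
   count (root p) B + \sum_(c <- B) prefix_weight (zero_pattern p^`() c n))%N.
  by rewrite -!sumn_count !sumnE !big_map -!big_split; apply: eq_bigr.
lia.
Qed.
End BudanFourier.

(** * Duality, existence of p, and greedy pairing *)

Lemma coef_XaddC_exp (R : comNzRingType) (a : R) e s :
  (('X + a%:P) ^+ e)`_s = a ^+ (e - s) *+ 'C(e, s).
Proof.
rewrite addrC exprDn coef_sum.
have coef_term i : ((a%:P ^+ (e - i) * 'X^i) *+ 'C(e, i))`_s =
    if s == i then a ^+ (e - s) *+ 'C(e, s) else 0.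
  rewrite coefMn -polyC_exp coefCM coefXn; case: eqP => [->|_].
    by rewrite mulr1.
  by rewrite mulr0 mul0rn.
under eq_bigr do rewrite coef_term.
have [le_s_e|lt_e_s] := leqP s e.
  by rewrite -big_mkcond (big_pred1 (Ordinal (le_s_e : s < e.+1)%N)).
rewrite big1 ?bin_small ?mulr0n // => i _.
by case: eqP (ltn_ord i) => // <-; rewrite ltnS leqNgt lt_e_s.
Qed.

(** This is the apolar pairing in degree D, up to signs. Its weights r! (D - r)! depend on neither a
    nor e, so a linear relation between the powers passes to the forms on the left. *)
Lemma derivn_horner_dual (R : comNzRingType) (p : {poly R}) (a : R) D e :
    (size p <= D.+1)%N -> (e <= D)%N ->
  p^`(D - e).[a] *+ e`! =
  \sum_(r < D.+1) p`_r *+ (r`! * (D - r)`!) * (('X + a%:P) ^+ e)`_(D - r).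
Proof.
move=> sz_p le_e_D.
have {1}-> : p = \sum_(r < D.+1) p`_r *: 'X^r.
  rewrite -poly_def; apply/polyP => i; rewrite coef_poly; case: ltnP => // le_D_i.
  by rewrite nth_default // (leq_trans sz_p).
rewrite raddf_sum horner_sum -sumrMnl; apply: eq_bigr => r _.
rewrite /= derivnZ hornerZ derivnXn hornerMn hornerXn coef_XaddC_exp.
have le_r_D : (r <= D)%N by rewrite -ltnS.
have [lt_e_s|le_s_e] := ltnP e (D - r).
  by rewrite bin_small // ffact_small ?mulr0n ?mulr0 ?mul0rn //; lia.
rewrite (_ : r - (D - e) = e - (D - r))%N; last by lia.
rewrite mulrnAr mulrnAl mulrnAr -!mulrnA; congr (_ *+ _).
rewrite -(bin_fact le_s_e) -[in RHS](@ffact_fact r (D - e)); last by lia.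
rewrite (_ : r - (D - e) = e - (D - r))%N; last by lia.
by lia.
Qed.

(** At most D homogeneous linear equations in D + 1 coefficients have a nonzero solution. *)
Lemma exists_poly_derivn_root (F : fieldType) D (s : seq (nat * F)) :
    (size s <= D)%N ->
  exists p : {poly F}, [/\ p != 0, (size p <= D.+1)%N &
    {in s, forall x, p^`(x.1).[x.2] = 0}].
Proof.
move=> sz_s; pose x0 : nat * F := (0%N, 0).
pose M := \matrix_(r < D.+1, j < size s)
  ('X^r)^`((nth x0 s j).1).[(nth x0 s j).2] : 'M[F]_(_, _).
have /rowV0Pn[v /sub_kermxP vM v0] : kermx M != 0.
  rewrite -mxrank_eq0 mxrank_ker subn_eq0 -ltnNge ltnS.
  exact: leq_trans (rank_leq_col M) sz_s.
exists (rVpoly v); split; last 1 first.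
- move=> x /(nthP x0)[j lt_j <-].
  move/rowP/(_ (Ordinal lt_j)): vM; rewrite !mxE => vMj.
  rewrite -[RHS]vMj /rVpoly poly_def raddf_sum horner_sum; apply: eq_bigr => r _.
  by rewrite /= derivnZ hornerZ !mxE insubT // => lt_r; congr (v _ _ * _); apply: val_inj.
- by apply: contraNneq v0 => rv0; rewrite -(rVpolyK v) rv0 linear0.
- exact: size_poly.
Qed.

(* The left ends of the pairs {n, n+1} chosen greedily, from below, to cover S. *)
Fixpoint pair_start (S : pred nat) n : bool :=
  S n && (if n is n'.+1 then ~~ pair_start S n' else true).

Lemma pair_start_sub (S : pred nat) n : pair_start S n -> S n.
Proof. by case: n => [|n] /= /andP[]. Qed.

Lemma pair_startS (S : pred nat) n : pair_start S n -> ~~ pair_start S n.+1.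
Proof. by move=> /= ->; rewrite andbF. Qed.

Lemma pair_start_cover (S : pred nat) n : S n ->
  pair_start S n \/ exists2 n', n = n'.+1 & pair_start S n'.
Proof.
case: n => [|n] /= Sn; rewrite Sn; first by left.
by case: (boolP (pair_start S n)) => Pn; [right; exists n|left].
Qed.

(** * The count for disjoint pairs of Birkhoff conditions *)

Section Birkhoff.
Variables (R : rcfType) (I : finType).

(** The zero at [b] is an initial run and counts in full; at every other point each pair counts 2.
    Only pairs with [q i <= n] carry information, and these lie within the first n derivatives
    because the n-th one has no root. *)
Lemma birkhoff_pairs_le (G : {set I}) (a : I -> R) (q : I -> nat)
    (p : {poly R}) n K b :
    size p = n.+1 ->
    {in G, forall i, root p^`(q i) (a i) /\ root p^`((q i).+1) (a i)} ->
    {in G &, forall i j, a i = a j -> q i = q j -> i = j} ->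
    {in G &, forall i j, a i = a j -> q j != (q i).+1} ->
    {in G, forall i, a i != b} ->
    (forall j, (j < K)%N -> root p^`(j) b) ->
  (K + (#|[set i in G | (q i <= n)%N]|).*2 <= n)%N.
Proof.
move=> sz_p rootG injG sepG Gb rootb.
have top c : ~~ root p^`(n) c.
  have /size_poly1P[x x0 ->] : size p^`(n) == 1%N.
    elim: n p sz_p {rootG rootb} => [|n IHn] p sz_p; first by rewrite sz_p.
    by rewrite derivSn IHn // size_deriv sz_p.
  by rewrite rootC.
have le_K_n : (K <= n)%N by rewrite leqNgt; apply: contra (top b); exact: rootb.
set H := [set i in G | _].
have HG i : i \in H -> i \in G by rewrite inE => /andP[].
have Hlt i : i \in H -> ((q i).+1 < n)%N.
  rewrite inE => /andP[iG]; have [r0 r1] := rootG i iG.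
  rewrite leq_eqVlt => /predU1P[qi|]; first by rewrite qi (negbTE (top _)) in r0.
  by rewrite leq_eqVlt => /predU1P[qi|//]; rewrite qi (negbTE (top _)) in r1.
pose u := undup [seq a i | i in H].
have uniq_bu : uniq (b :: u).
  rewrite /= undup_uniq andbT mem_undup; apply/negP => /imageP[i iH bi].
  by have := Gb i (HG i iH); rewrite -bi eqxx.
apply: leq_trans (sum_prefix_weight_le sz_p uniq_bu).
rewrite big_cons leq_add //.
  apply: leq_prefix_weight => j lt_j_K.
  by rewrite nth_mkseq ?rootb // (leq_trans lt_j_K).
have -> : #|H| = (\sum_(c <- u) #|[set i in H | a i == c]|)%N.
  under eq_bigr do rewrite -sum1_card.
  rewrite (exchange_big_dep (mem H)) /=; last by move=> c i _; rewrite inE => /andP[].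
  rewrite -sum1_card; apply: eq_bigr => i iH.
  rewrite (eq_bigl (pred1 (a i))) => [|c]; last by rewrite inE iH /= eq_sym.
  rewrite sum1_count count_uniq_mem ?undup_uniq // mem_undup.
  by rewrite image_f.
rewrite -muln2 big_distrl /=; apply: leq_sum => c _; rewrite muln2.
apply: leq_trans (leq_paired_prefix_weight _).
set Hc := [set i in H | _].
have HcP i : i \in Hc -> i \in H /\ a i = c.
  by rewrite inE => /andP[-> /eqP].
rewrite cardE -(size_map q); apply: leq_seq_pairs_weight.
  rewrite map_inj_in_uniq ?enum_uniq // => i j.
  rewrite !mem_enum => /HcP[iH ai] /HcP[jH aj]; apply: injG; rewrite ?HG //.
  by rewrite ai aj.
move=> _ /mapP[i /[!mem_enum]/HcP[iH ai] ->].
have [r0 r1] := rootG i (HG i iH); rewrite ai in r0 r1.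
rewrite !nth_mkseq ?Hlt ?(ltnW (Hlt _ _)) //; split=> //.
apply/mapP => -[j /[!mem_enum]/HcP[jH aj] qj].
by have := sepG i j (HG i iH) (HG j jH); rewrite ai aj qj eqxx => /(_ erefl).
Qed.

End Birkhoff.

(** * A linear relation against the count *)

Theorem theorem1 (R : realType) (k : nat) (f : 'I_k -> {poly R})
    (a : 'I_k -> R) (e : 'I_k -> nat)
    (f_def : forall i : 'I_k, f i = ('X + (a i)%:P) ^+ (e i))
    (f_distinct : injective f)
    (n1_le : (num_deg_lt f 1 <= 1)%N)
    (nj_le : forall j : nat, (2 <= j)%N ->
       (num_deg_lt f j + num_deg_lt f (j - 1) <= j)%N) :
  linearly_independent f.
Proof.
move=> c sum_c i0; apply/eqP/negPn/negP => ci0.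
have deg_f i : degree (f i) = e i.
  by rewrite /degree f_def -[a i]opprK polyCN size_exp_XsubC.
have inj_ae i j : a i = a j -> e i = e j -> i = j.
  by move=> aij eij; apply: f_distinct; rewrite !f_def aij eij.
pose S x : pred nat := fun m => [exists j, (a j == x) && (e j == m)].
pose G := [set i | pair_start (S (a i)) (e i)].
have coverG i : exists2 g, g \in G & a g = a i /\ (e i = e g \/ e i = (e g).+1).
  have Si : S (a i) (e i) by apply/existsP; exists i; rewrite !eqxx.
  have [Pi|[m ei Pm]] := pair_start_cover Si.
    by exists i; rewrite ?inE //; split=> //; left.
  have /existsP[j /andP[/eqP aj /eqP ej]] := pair_start_sub Pm.
  by exists j; rewrite ?inE aj ej //; split=> //; right.
(* Any [D] above all exponents and at least twice the number of pairs would do; it keeps the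
   subtractions defining [q] and [K] exact. *)
pose D := (k.*2 + (\sum_i e i).+1)%N.
have lt_e_D i : (e i < D)%N.
  by rewrite /D addnS ltnS (leq_trans _ (leq_addl _ _)) // (bigD1 i) ?leq_addr.
have le_G_D : (#|G|.*2 <= D)%N.
  by rewrite (leq_trans _ (leq_addr _ _)) // leq_double -[leqRHS]card_ord max_card.
(* Exponent e becomes derivation order D - e, which reverses the order: the pair {e, e+1} becomes
   {[q i], [q i] + 1}, and [q i] belongs to e + 1. *)
pose q i := (D - (e i).+1)%N.
have qS i : (q i).+1 = (D - e i)%N by rewrite /q subnSK.
pose K := (D.+1 - #|G|.*2)%N.
pose b := 1 + \sum_i `|a i|.
have b_a i : a i != b.
  apply: contraTneq isT => /(congr1 (fun x => x <= \sum_i `|a i|)).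
  rewrite /b [RHS]leNgt ltrDr ltr01 /= (le_trans (ler_norm _)) //.
  by rewrite (bigD1 i) //= lerDl sumr_ge0.
pose L := [seq (j, b) | j <- iota 0 K] ++
  [seq (q i, a i) | i <- enum G] ++ [seq ((q i).+1, a i) | i <- enum G].
have sz_L : size L = D.+1.
  rewrite !size_cat !size_map size_iota -cardE /K; lia.
pose x i := ((D - e i)%N, a i).
have x_L i : x i \in L.
  have [g gG [ag [eg|eg]]] := coverG i; rewrite /x -ag !mem_cat eg.
    by rewrite -qS (map_f (fun i => ((q i).+1, a i))) ?orbT // mem_enum.
  by rewrite -/(q g) (map_f (fun i => (q i, a i))) ?orbT // mem_enum.
have inj_x : injective x.
  move=> i j [Dij aij]; apply: inj_ae => //.
  by have := lt_e_D i; have := lt_e_D j; lia.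
have [|p [p0 sz_p pL']] := @exists_poly_derivn_root _ D (rem (x i0) L).
  by rewrite size_rem // sz_L.
(* The condition at [i0] was removed to make room for p; the relation restores it, as all its other
   terms vanish and [c i0] is nonzero. *)
have rootx i : p^`(D - e i).[a i] = 0.
  have other j : j != i0 -> p^`(D - e j).[a j] = 0.
    move=> ji0; apply: (pL' (x j)).
    have := perm_mem (perm_to_rem (x_L i0)) (x j).
    by rewrite x_L inE (inj_eq inj_x) (negbTE ji0).
  have [->|/other//] := eqVneq i i0.
  have : \sum_i c i * (p^`(D - e i).[a i] *+ (e i)`!) = 0.
    under eq_bigr do rewrite (derivn_horner_dual _ sz_p (ltnW (lt_e_D _))) mulr_sumr.
    rewrite exchange_big big1 //= => r _.
    under eq_bigr do rewrite mulrCA -f_def -coefZ.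
    by rewrite -mulr_sumr -coef_sum sum_c coef0 mulr0.
  rewrite (bigD1 i0) //= big1 => [|j /other->]; last by rewrite mul0rn mulr0.
  rewrite addr0 => /eqP; rewrite mulf_eq0 (negbTE ci0) mulrn_eq0 /=.
  by rewrite -leqn0 leqNgt fact_gt0 /= => /eqP.
have rootL y : y \in L -> root p^`(y.1) y.2.
  rewrite (perm_mem (perm_to_rem (x_L i0))) inE => /predU1P[->|/pL' y0].
    exact/eqP/rootx.
  exact/eqP.
have rootG i : i \in G -> root p^`(q i) (a i) /\ root p^`((q i).+1) (a i).
  move=> iG; split.
    apply: (rootL (q i, a i)).
    by rewrite !mem_cat (map_f (fun i => (q i, a i))) ?orbT // mem_enum.
  by rewrite qS; exact/eqP/rootx.
have rootb j : (j < K)%N -> root p^`(j) b.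
  move=> ltj; apply: (rootL (j, b)).
  by rewrite mem_cat (map_f (fun j => (j, b))) // mem_iota.
have injG : {in G &, forall i j, a i = a j -> q i = q j -> i = j}.
  move=> i j _ _ aij qij; apply: inj_x; congr (_, _) => //.
  by rewrite -!qS qij.
have sepG : {in G &, forall i j, a i = a j -> q j != (q i).+1}.
  move=> i j; rewrite !inE => Pi Pj aij; apply/eqP => qji.
  have eij : e i = (e j).+1.
    by have := lt_e_D i; have := lt_e_D j; move: qji; rewrite /q; lia.
  by move: Pi; rewrite eij aij (negbTE (pair_startS Pj)).
case sz_pn : (size p) => [|n]; first by rewrite -size_poly_gt0 sz_pn in p0.
have := birkhoff_pairs_le sz_pn rootG injG sepG (fun i _ => b_a i) rootb.
have le_n_D : (n <= D)%N by rewrite sz_pn in sz_p.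
pose T j := [set i | (e i < j)%N].
have numT j : num_deg_lt f j = #|T j|.
  by apply: eq_card => i; rewrite !inE deg_f.
(* A pair with [q i > n] has [e i < D - n - 1]. *)
have : (#|[set i in G | (q i <= n)%N]| + #|T (D - n).-1| >= #|G|)%N.
  rewrite (leq_trans _ (leq_card_setU _ _)) // subset_leq_card //.
  apply/subsetP => i iG; rewrite in_setU inE iG /=; case: leqP => //= lt_n_q.
  by rewrite inE; move: lt_n_q; rewrite /q; lia.
(* This is the hypothesis at j = D - n together with n_(j-1) <= n_j; for D - n <= 1 the set is
   empty, as no exponent is below 0. *)
have : ((#|T (D - n).-1|).*2 <= D - n)%N.
  case: (ltnP 1 (D - n)) => [/nj_le|].
    rewrite !numT subn1 -addnn; apply: leq_trans; rewrite leq_add2r.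
    by apply: subset_leq_card; apply/subsetP => i; rewrite !inE; lia.
  move=> le1; rewrite (_ : T _ = set0) ?cards0 //.
  by apply/setP => i; rewrite !inE; lia.
rewrite /K; lia.
Qed.
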